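(* Let $d\ge 2$ be a fixed integer. There exists a constant $C_d$ depending only on $d$ and a randomized algorithm (called Rough Estimation) which, given the vertex set $U$ (with $|U|=n$) of an unknown $d$-uniform hypergraph $\mathcal{H}=(U,\mathcal{F})$ and access to $\mathcal{H}$ only through a Colorful Independence (CID) oracle, returns an estimate $\widehat{m}$ of $m=|\mathcal{F}|$ such that $$\frac{1}{C_d\log^{d-1} n}\;\le\;\frac{\widehat{m}}{m}\;\le\; C_d\log^{d-1} n$$ with probability at least $1-1/n^{\Omega(d)}$, using at most $C_d\log^{d+2} n$ CID queries.
   Context: A hypergraph $\mathcal{H}=(U,\mathcal{F})$ consists of a vertex set $U$ and a set $\mathcal{F}$ of subsets of $U$ (hyperedges); it is $d$-uniform if every hyperedge has exactly $d$ vertices. For subsets $A_1,\dots,A_d\subseteq U$, $m(A_1,\dots,A_d)$ denotes the number of hyperedges having exactly one vertex in each $A_i$. The CID (colorful independence) oracle takes as input $d$ pairwise disjoint nonempty subsets $A_1,\dots,A_d\subseteq U$ and answers Yes if and only if $m(A_1,\dots,A_d)\neq 0$. Logarithms are base 2. *)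

(* Defs.v *)
From HB Require Import structures.
From mathcomp Require Import all_boot all_order all_algebra.
From mathcomp Require Import all_classical all_reals exp.

Set Implicit Arguments.
Unset Strict Implicit.
Unset Printing Implicit Defensive.

Import Order.TTheory GRing.Theory Num.Theory.

Local Open Scope ring_scope.

(* A hypergraph on the vertex set U is given by its set of hyperedges. *)
Definition hypergraph (U : finType) := {set {set U}}.

Definition uniform_hypergraph (U : finType) (d : nat) (H : hypergraph U) :=
  [forall e in H, #|e| == d].

Definition colorful_count (U : finType) (d : nat) (H : hypergraph U)
    (A : {ffun 'I_d -> {set U}}) : nat :=
  #|[set e in H | [forall i, #|e :&: A i| == 1%N]]|.

Definition valid_query (U : finType) (d : nat)
    (A : {ffun 'I_d -> {set U}}) : bool :=
  [forall i, A i != finset.set0] &&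
  [forall i, forall j, (i != j) ==> [disjoint A i & A j]].

Definition cid_query (U : finType) (d : nat) :=
  {A : {ffun 'I_d -> {set U}} | valid_query A}.

Definition cid_oracle (U : finType) (d : nat) (H : hypergraph U)
    (q : cid_query U d) : bool :=
  colorful_count H (val q) != 0%N.

(* Randomized query algorithms, as finitely branching decision trees: [Rand k f]
   draws i uniformly from {0, ..., k} and continues as f i; [Query q f] asks the
   oracle q and continues as f b, where b is the answer.  The tree has no other
   access to the hypergraph. *)
Inductive cid_algorithm (U : finType) (d : nat) (T : Type) : Type :=
| Return of T
| Rand (k : nat) of ('I_k.+1 -> cid_algorithm U d T)
| Query of cid_query U d & (bool -> cid_algorithm U d T).

Fixpoint output_prob (R : realType) (U : finType) (d : nat) (T : Type)
    (O : cid_query U d -> bool) (E : pred T) (p : cid_algorithm U d T) : R :=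
  match p with
  | Return t => (E t)%:R
  | Rand k f => (\sum_(i < k.+1) output_prob R O E (f i)) / k.+1%:R
  | Query q f => output_prob R O E (f (O q))
  end.

(* Largest number of queries made over all outcomes of the random draws. *)
Fixpoint num_queries (U : finType) (d : nat) (T : Type)
    (O : cid_query U d -> bool) (p : cid_algorithm U d T) : nat :=
  match p with
  | Return _ => 0
  | Rand k f => \max_(i < k.+1) num_queries O (f i)
  | Query q f => (num_queries O (f (O q))).+1
  end.

Definition log2 (R : realType) (x : R) : R := ln x / ln 2.

(* For m = 0 the ratio is meaningless; as in m / K <= mhat <= K * m, the
   estimate is then required to be exact. *)
Definition estimates_within (R : realType) (K : R) (m : nat) : pred R :=
  fun mhat =>
    if m == 0%N then mhat == 0 else (1 / K <= mhat / m%:R <= K).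

(* Main.v *)
(** One trial at level s colours the vertices uniformly with d colours, draws
  scales t_1, ..., t_d with t_1 + ... + t_d = s, keeps each vertex of colour i
  with probability 2 ^ - t_i, and asks the oracle about the d sets obtained.
  A hyperedge survives with probability at most 2 ^ - s, so the answer is
  positive with probability at most m 2 ^ - s.  Conversely this probability is
  at least a constant times min (1, m 2 ^ - s) / (s + 1) ^ (d - 1), by induction
  on d.  Let N_t be the number of vertices lying in at least 2 ^ (s - t) of the
  hyperedges.  The first set, drawn at scale t, meets these vertices with
  probability at least min (1, N_t 2 ^ - t) / 2, the link of such a vertex has
  at least 2 ^ (s - t) hyperedges, and the sum of N_t 2 ^ - t over t <= s is at
  least min (1, m 2 ^ - s).
  By Chernoff bounds, polylogarithmically many trials separate the levels s with
  2 ^ s <= m from those with 2 ^ s much larger than m log ^ (d - 1) n; the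
  algorithm returns 2 ^ s for the largest level s that is accepted. *)

Require Import Defs.
From HB Require Import structures.
From mathcomp Require Import all_boot all_order all_algebra.
From mathcomp Require Import all_classical all_reals sequences exp.
From mathcomp Require Import ring lra zify.
Import Order.TTheory GRing.Theory Num.Theory.
Local Open Scope ring_scope.

Set Implicit Arguments.
Unset Strict Implicit.
Unset Printing Implicit Defensive.

(** * Query algorithms *)

Section Algorithms.
Variables (U : finType) (d : nat).

Fixpoint bind (S T : Type) (p : cid_algorithm U d S)
    (k : S -> cid_algorithm U d T) : cid_algorithm U d T :=
  match p with
  | Return t => k t
  | Rand _ f => Rand (fun i => bind (f i) k)
  | Query q f => Query q (fun b => bind (f b) k)
  end.

(** [Rand] draws from one value more than its argument, hence the predecessor; [x0] witnesses that
    [I] is nonempty. *)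
Definition uniform (I : finType) (x0 : I) : cid_algorithm U d I :=
  @Rand U d I #|I|.-1 (fun i => Return U d (nth x0 (enum I) i)).

(* Every vertex is kept with probability 2 ^ - t, independently. *)
Definition sparse_set (t : nat) : cid_algorithm U d {set U} :=
  bind (uniform [ffun _ : U => ord0 : 'I_(2 ^ t).-1.+1])
    (fun f => Return U d [set v | f v == ord0]).

(* The rates 2 ^ - t_i of the k.+1 sets satisfy t_0 + ... + t_k = s. *)
Fixpoint sparse_sets (k s : nat) : cid_algorithm U d (k.+1.-tuple {set U}) :=
  match k with
  | 0 => bind (sparse_set s) (fun X => Return U d [tuple X])
  | k'.+1 => @Rand U d _ s (fun t => bind (sparse_set t) (fun X =>
      bind (sparse_sets k' (s - t)) (fun Xs =>
        Return U d [tuple of X :: Xs])))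
  end.

(** Oracle queries carry a proof of validity. For disjoint sets, invalidity means that one of them
    is empty, and then [false] is the true answer. *)
Definition ask (A : {ffun 'I_d -> {set U}}) : cid_algorithm U d bool :=
  if insub A is Some q then Query q (fun b => Return U d b)
  else Return U d false.

Fixpoint count_yes (p : cid_algorithm U d bool) (N : nat) :
    cid_algorithm U d nat :=
  if N is N'.+1 then
    bind p (fun b => bind (count_yes p N') (fun y => Return U d (b + y)%N))
  else Return U d 0%N.

(** * Output probabilities and query counts *)

Variables (R : realType) (O : cid_query U d -> bool).

Local Notation prob := (output_prob R O).

Lemma output_prob_ge0 T (E : pred T) p : 0 <= prob E p.
Proof.
elim: p => [t|k f IH|q f IH] //=.
by rewrite divr_ge0 ?ler0n // sumr_ge0.
Qed.

Lemma le_output_prob T (E E' : pred T) p :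
  subpred E E' -> prob E p <= prob E' p.
Proof.
move=> sub; elim: p => [t|k f IH|q f IH] //=.
  by case Et: (E t) => //; rewrite (sub _ Et).
by rewrite ler_pM2r ?invr_gt0 ?ltr0n // ler_sum.
Qed.

Lemma output_probC T (E : pred T) p : prob E p = 1 - prob (predC E) p.
Proof.
elim: p => [t|k f IH|q f IH] //=; first by case: (E t); rewrite ?subr0 ?subrr.
under eq_bigr do rewrite IH.
rewrite sumrB sumr_const card_ord mulrBl divff //.
by rewrite pnatr_eq0.
Qed.

Lemma output_prob_le1 T (E : pred T) p : prob E p <= 1.
Proof. by rewrite output_probC gerBl output_prob_ge0. Qed.

Lemma output_prob_map S T (E : pred T) (h : S -> T) p :
  prob E (bind p (fun x => Return U d (h x))) = prob (E \o h) p.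
Proof.
elim: p => [t|k f IH|q f IH] //=.
by under eq_bigr do rewrite IH.
Qed.

Lemma output_prob_bindA S S' T (E : pred T) p
    (k : S -> cid_algorithm U d S') (k' : S' -> cid_algorithm U d T) :
  prob E (bind (bind p k) k') = prob E (bind p (fun x => bind (k x) k')).
Proof.
elim: p => [t|j f IH|q f IH] //=.
by under eq_bigr do rewrite IH.
Qed.

Lemma eq_output_prob_bind S T (E : pred T) p
    (k k' : S -> cid_algorithm U d T) :
  (forall x, prob E (k x) = prob E (k' x)) ->
  prob E (bind p k) = prob E (bind p k').
Proof.
move=> eqk; elim: p => [t|j f IH|q f IH] //=.
by under eq_bigr do rewrite IH.
Qed.

Lemma output_prob_bind_bool T (E : pred T) p (k : bool -> cid_algorithm U d T) :
  prob E (bind p k) =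
  prob id p * prob E (k true) + (1 - prob id p) * prob E (k false).
Proof.
elim: p => [[]|j f IH|q f IH] //=; rewrite ?subrr ?subr0 ?mul0r ?mul1r ?addr0 ?add0r //.
under eq_bigr do rewrite IH.
rewrite big_split /= -!mulr_suml sumrB sumr_const card_ord.
have : j.+1%:R != 0 :> R by rewrite pnatr_eq0.
by move: (\sum_(i < _) _) j.+1%:R => s z z0; field.
Qed.

Definition mean (I : finType) (F : I -> R) : R := (\sum_x F x) / #|I|%:R.

Lemma ler_mean (I : finType) (F G : I -> R) :
  (forall x, F x <= G x) -> mean F <= mean G.
Proof.
by move=> leFG; rewrite /mean ler_wpM2r ?invr_ge0 ?ler0n // ler_sum.
Qed.

Lemma mean_sum (I J : finType) (F : J -> I -> R) :
  mean (fun x => \sum_j F j x) = \sum_j mean (F j).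
Proof. by rewrite /mean exchange_big mulr_suml. Qed.

Lemma mean_scale (I : finType) (a : R) (F : I -> R) :
  mean (fun x => a * F x) = a * mean F.
Proof. by rewrite /mean -mulr_sumr mulrA. Qed.

Lemma output_prob_bind_uniform (I : finType) (x0 : I) T (E : pred T) k :
  prob E (bind (uniform x0) k) = mean (fun x => prob E (k x)).
Proof.
have cI : #|I|.-1.+1 = #|I| by rewrite prednK //; apply/card_gt0P; exists x0.
rewrite /mean /=; congr (_ / _%:R); last exact: cI.
by rewrite -[RHS]big_enum /= (big_nth x0) -cardE -[in RHS]cI big_mkord.
Qed.

Lemma num_queries_bind S T (p : cid_algorithm U d S)
    (k : S -> cid_algorithm U d T) b :
  (forall x, num_queries O (k x) <= b)%N ->
  (num_queries O (bind p k) <= num_queries O p + b)%N.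
Proof.
move=> kb; elim: p => [t|j f IH|q f IH] //=; last by rewrite addSn ltnS.
by apply/bigmax_leqP => i _; apply: leq_trans (IH i) _; rewrite leq_add2r (leq_bigmax i).
Qed.

Lemma num_queries_map S T (p : cid_algorithm U d S) (h : S -> T) :
  (num_queries O (bind p (fun x => Return U d (h x))) <= num_queries O p)%N.
Proof. by rewrite -[leqRHS]addn0 num_queries_bind. Qed.

Lemma num_queries_rand T j (f : 'I_j.+1 -> cid_algorithm U d T) b :
  (forall i, num_queries O (f i) <= b)%N -> (num_queries O (Rand f) <= b)%N.
Proof. by move=> fb; apply/bigmax_leqP. Qed.

Lemma num_queries_uniform (I : finType) (x0 : I) :
  num_queries O (uniform x0) = 0%N.
Proof. by apply/eqP; rewrite -leqn0; apply/bigmax_leqP. Qed.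

Lemma num_queries_sparse_set t : num_queries O (sparse_set t) = 0%N.
Proof.
apply/eqP; rewrite -leqn0; apply: leq_trans (num_queries_map _ _) _.
by rewrite num_queries_uniform.
Qed.

Lemma num_queries_sparse_sets k s : num_queries O (sparse_sets k s) = 0%N.
Proof.
elim: k s => [|k IH] s; apply/eqP; rewrite -leqn0.
  by apply: leq_trans (num_queries_map _ _) _; rewrite num_queries_sparse_set.
apply: num_queries_rand => t.
apply: (@leq_trans (num_queries O (sparse_set t) + 0)%N); last first.
  by rewrite addn0 num_queries_sparse_set.
apply: (@num_queries_bind _ _ (sparse_set t)) => X.
by apply: leq_trans (num_queries_map _ _) _; rewrite IH.
Qed.

Lemma num_queries_ask A : (num_queries O (ask A) <= 1)%N.
Proof. by rewrite /ask; case: insub. Qed.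

Lemma num_queries_count_yes p N :
  (num_queries O p <= 1)%N -> (num_queries O (count_yes p N) <= N)%N.
Proof.
move=> p1; elim: N => //= N IH.
rewrite -addn1 addnC; apply: leq_trans (num_queries_bind _ _) _.
  by move=> b; apply: leq_trans (num_queries_map _ _) IH.
by rewrite leq_add2r.
Qed.

(* The number Y of positive answers in N independent trials of probability q has
   E[x ^ Y] = (1 + (x - 1) q) ^ N; this is Chernoff's method for both tails. *)
Lemma count_yes_moment T (E : pred T) p k N (a b x : R) :
  0 <= a -> 0 <= x ->
  (forall y, prob E (k y) <= a * x ^+ y + b) ->
  prob E (bind (count_yes p N) k) <= a * (1 + (x - 1) * prob id p) ^+ N + b.
Proof.
move=> a0 x0; elim: N k a b a0 => [|N IH] k a b a0 kab /=.
  by have := kab 0%N; rewrite !expr0.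
rewrite output_prob_bindA output_prob_bind_bool.
rewrite 2!(output_prob_bindA _ (count_yes p N)).
set q := prob id p; set w := 1 + (x - 1) * q.
have qge0 : 0 <= q by exact: output_prob_ge0.
have qle1 : q <= 1 by exact: output_prob_le1.
(* A positive answer contributes a factor [x], so the induction hypothesis is used with coefficient
   [a * x]. *)
have h1 : prob E (bind (count_yes p N) (fun y => k (true + y)%N)) <=
    (a * x) * w ^+ N + b.
  apply: IH; first by rewrite mulr_ge0.
  by move=> y; rewrite -mulrA -exprS -add1n.
have h0 : prob E (bind (count_yes p N) (fun y => k (false + y)%N)) <=
    a * w ^+ N + b by apply: IH.
apply: le_trans (lerD (ler_wpM2l qge0 h1) (ler_wpM2l _ h0)) _.
  by rewrite subr_ge0.
by rewrite le_eqVlt exprS {3}/w; apply/orP; left; apply/eqP; ring.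
Qed.
End Algorithms.

(** * Sparse random sets *)

(** With x = N p, induction on N gives (1 - p)^N (1 + x) <= 1; then x / (1 + x) is at least 1/2 if x
    >= 1, and at least x / 2 otherwise. *)
Lemma bernoulli_half (R : realType) (p : R) (N : nat) :
  0 <= p <= 1 -> Num.min 1 (N%:R * p) / 2 <= 1 - (1 - p) ^+ N.
Proof.
move=> /andP[p0 p1]; set x := N%:R * p.
have x0 : 0 <= x by rewrite mulr_ge0.
have h : (1 - p) ^+ N * (1 + x) <= 1.
  rewrite /x; elim: N {x x0} => [|N IH]; first by rewrite expr0; lra.
  have w0 : 0 <= (1 - p) ^+ N by rewrite exprn_ge0 // subr_ge0.
  have n0 : 0 <= N%:R :> R by [].
  have w1 : (1 - p) ^+ N <= 1 by rewrite exprn_ile1 ?subr_ge0 // gerBl.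
  rewrite exprS -[N.+1%:R]natr1; move: ((1 - p) ^+ N) w0 w1 IH => w w0 w1 IH.
  have := ler_wpM2l (_ : 0 <= 1 - p) IH; rewrite subr_ge0 => /(_ p1) h.
  have := mulr_ge0 p0 w0; have := mulr_ge0 (mulr_ge0 p0 p0) w0.
  have := ler_wpM2l p0 w1; lra.
have w0 : 0 <= (1 - p) ^+ N by rewrite exprn_ge0 // subr_ge0.
by case: (lerP 1 x) => hx; nra.
Qed.

Lemma min_sum (R : realType) (I : finType) (F : I -> R) :
  (forall i, 0 <= F i) -> Num.min 1 (\sum_i F i) <= \sum_i Num.min 1 (F i).
Proof.
move=> F0.
suff [] : Num.min 1 (\sum_i F i) <= \sum_i Num.min 1 (F i) /\ 0 <= \sum_i F i by [].
elim/big_rec2: _ => [|i y x _ []]; first by rewrite ge_min lexx orbT.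
have := F0 i.
case: (lerP 1 x); case: (lerP 1 (F i + x)); case: (lerP 1 (F i)) => *; split; lra.
Qed.

(** The powers of two not exceeding c sum to at least c, unless the cut at exponent s intervenes;
    then all of them are present and sum to 2^(s+1) - 1. *)
Lemma dyadic_layers (s c : nat) :
  (minn (2 ^ s.+1).-1 c <= \sum_(b < s.+1) (2 ^ b <= c) * 2 ^ b)%N.
Proof.
elim: s => [|s IH].
  by rewrite big_ord1 expn0 muln1 expn1; case: c => //= c; rewrite geq_minl.
rewrite big_ord_recr /=; set x := \sum_(_ < _) _ in IH *.
have := expn_gt0 2 s.+1; rewrite [(2 ^ s.+2)%N]expnS; move: IH.
by move: (2 ^ s.+1)%N => z; case: leqP => /=; lia.
Qed.

(** The coordinates of a uniformly random function are independent. *)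
Lemma mean_prod (R : realType) (I J : finType) (F : I -> J -> R) :
  mean (fun f : {ffun I -> J} => \prod_i F i (f i)) = \prod_i mean (F i).
Proof.
rewrite /mean prodf_div -bigA_distr_bigA /=.
by rewrite prodr_const card_ffun natrX.
Qed.

Lemma mean_cst (R : realType) (I : finType) (a : R) :
  (0 < #|I|)%N -> mean (fun _ : I => a) = a.
Proof.
by move=> I0; rewrite /mean sumr_const -[a *+ _]mulr_natr mulfK // pnatr_eq0 -lt0n.
Qed.

Section SparseSets.
Variables (R : realType) (U : finType).

(** Expectation over the output of [sparse_set t]. The bound [(2 ^ t).-1.+1] is 2^t in a form for
    which [ord0] is typable. *)
Definition sparse_mean (t : nat) (F : {set U} -> R) : R :=
  mean (fun f : {ffun U -> 'I_(2 ^ t).-1.+1} => F [set v | f v == ord0]).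

Lemma ler_sparse_mean t (F G : {set U} -> R) :
  (forall X, F X <= G X) -> sparse_mean t F <= sparse_mean t G.
Proof. by move=> FG; apply: ler_mean. Qed.

Lemma sparse_meanC t (P : pred {set U}) :
  sparse_mean t (fun X => (~~ P X)%:R) = 1 - sparse_mean t (fun X => (P X)%:R).
Proof.
have c0 : #|{ffun U -> 'I_(2 ^ t).-1.+1}|%:R != 0 :> R.
  by rewrite pnatr_eq0 -lt0n; apply/card_gt0P; exists [ffun => ord0].
apply: (mulIf c0); rewrite /sparse_mean /mean mulrBl !divfK // mul1r.
rewrite -sumr_const -sumrB.
by apply: eq_bigr => f _; case: (P _); rewrite ?subr0 ?subrr.
Qed.

Lemma sparse_avoid t (B : {set U}) :
  sparse_mean t (fun X => [disjoint B & X]%:R) = (1 - 2 ^- t) ^+ #|B|.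
Proof.
have M : (2 ^ t).-1.+1 = (2 ^ t)%N by rewrite prednK // expn_gt0.
(* The event factors over the vertices: those of [B] must draw a nonzero value, the others are
   free. *)
pose F (v : U) (c : 'I_(2 ^ t).-1.+1) : R := ((v \in B) ==> (c != ord0))%:R.
transitivity (mean (fun f : {ffun U -> 'I_(2 ^ t).-1.+1} => \prod_v F v (f v))).
  congr (mean _); apply/funext => f; case: (boolP [disjoint _ & _]) => dB.
    rewrite big1 // => v _; rewrite /F; case: (boolP (v \in B)) => //= vB.
    by have := disjointFr dB vB; rewrite inE => ->.
  move/pred0Pn: dB => [v /=]; rewrite inE => /andP[vB fv].
  by rewrite (bigD1 v) //= /F vB fv /= mul0r.
rewrite mean_prod -prodr_const [RHS]big_mkcond /=; apply: eq_bigr => v _.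
rewrite /F; case: (v \in B) => /=; last by rewrite mean_cst ?card_ord.
rewrite /mean (bigD1 ord0) //= add0r (eq_bigr (fun=> 1)) => [|c ->] //.
rewrite sumr_const cardC1 card_ord [in X in _ / X]M natrX.
have -> : (2 ^ t).-1%:R = 2 ^+ t - 1 :> R by rewrite -natrX -{2}M -natr1 addrK.
by rewrite mulrBl divff ?mul1r // expf_neq0 // pnatr_eq0.
Qed.

Lemma sparse_mem t (v : U) : sparse_mean t (fun X => (v \in X)%:R) = 2 ^- t.
Proof.
have := sparse_avoid t [set v]; rewrite cards1 expr1 => h.
rewrite -[RHS]opprK -[- 2 ^- t](addrK 1) [- _ + 1]addrC -h opprB -sparse_meanC.
by apply: congr1; apply/funext => X; rewrite disjoints1 negbK.
Qed.

Lemma sparse_hit t (B : {set U}) :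
  Num.min 1 (#|B|%:R * 2 ^- t) / 2 <=
  sparse_mean t (fun X => (~~ [disjoint B & X])%:R).
Proof.
apply: le_trans (bernoulli_half _ _) _.
  by rewrite invr_ge0 exprn_ge0 // invf_le1 ?exprn_ege1 ?exprn_gt0 ?ler1n.
by rewrite -sparse_avoid -sparse_meanC.
Qed.

(** * Tuples met by independent sparse sets *)

Definition tuple_count (k : nat) (E : seq U -> bool) : nat :=
  \sum_(t : k.-tuple U) E t.

Lemma tuple_countS k E :
  tuple_count k.+1 E = (\sum_v tuple_count k (fun t => E (v :: t)))%N.
Proof.
rewrite /tuple_count pair_big /=.
rewrite (reindex (fun p : U * k.-tuple U => [tuple of p.1 :: p.2])) //=.
exists (fun t => (thead t, [tuple of behead t])) => [[v t] _|t _] /=.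
  by congr (_, _); apply: val_inj.
by rewrite [RHS]tuple_eta.
Qed.

Lemma tuple_count0 E : tuple_count 0 E = E [::].
Proof.
rewrite /tuple_count (big_pred1 [tuple]) // => t; apply/esym/eqP.
exact: tuple0.
Qed.

(** The union of the links of the vertices of [X]. Predicates live on sequences of any length, so
    that passing to a link preserves their type. *)
Definition link (X : {set U}) (E : seq U -> bool) (t : seq U) : bool :=
  [exists v in X, E (v :: t)].

Lemma tuple_count_link k X E :
  (tuple_count k (link X E) <=
   \sum_(v in X) tuple_count k (fun t => E (v :: t)))%N.
Proof.
rewrite /tuple_count exchange_big leq_sum //= => t _.
rewrite /link; case: existsP => // -[v /andP[vX Ev]].
by rewrite (bigD1 v) //= Ev.
Qed.

Fixpoint hit (Xs : seq {set U}) (E : seq U -> bool) : bool :=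
  if Xs is X :: Xs' then hit Xs' (link X E) else E [::].

Lemma hitP Xs (E : seq U -> bool) :
  reflect (exists2 t : seq U, E t & all2 (fun v (X : {set U}) => v \in X) t Xs)
          (hit Xs E).
Proof.
elim: Xs E => [|X Xs IH] E /=.
  by apply: (iffP idP) => [h|[[|//] //]]; exists [::].
apply: (iffP (IH _)) => [[t /existsP[v /andP[vX Ev]] h]|[[|v t] //= Ev]].
  by exists (v :: t) => //=; rewrite vX.
by case/andP=> vX h; exists t => //; apply/existsP; exists v; rewrite vX.
Qed.

Lemma hit_sub Xs (E E' : seq U -> bool) :
  (forall t, E t -> E' t) -> hit Xs E -> hit Xs E'.
Proof. by move=> sub /hitP[t Et h]; apply/hitP; exists t; first apply: sub. Qed.

Variables (d : nat) (O : cid_query U d -> bool).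

Definition hit_prob k s (E : seq U -> bool) : R :=
  output_prob R O (fun Xs : k.+1.-tuple {set U} => hit Xs E)
    (sparse_sets U d k s).

Lemma output_prob_bind_sparse_set t T (E : pred T) k :
  output_prob R O E (bind (sparse_set U d t) k) =
  sparse_mean t (fun X => output_prob R O E (k X)).
Proof. by rewrite output_prob_bindA output_prob_bind_uniform. Qed.

Lemma hit_prob0 s E :
  hit_prob 0 s E = sparse_mean s (fun X => (link X E [::])%:R).
Proof. by rewrite /hit_prob /sparse_sets output_prob_bind_sparse_set. Qed.

Lemma hit_probS k s E :
  hit_prob k.+1 s E =
  (\sum_(t < s.+1) sparse_mean t (fun X => hit_prob k (s - t) (link X E)))
    / s.+1%:R.
Proof.
have rand T (E' : pred T) f : output_prob R O E' (@Rand U d T s f) =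
  (\sum_i output_prob R O E' (f i)) / s.+1%:R by [].
rewrite [LHS]rand; congr (_ / _); apply: eq_bigr => t _.
rewrite output_prob_bind_sparse_set; congr (mean _); apply/funext => f.
exact: output_prob_map.
Qed.

Lemma hit_prob_sub k s (E E' : seq U -> bool) :
  (forall t, E t -> E' t) -> hit_prob k s E <= hit_prob k s E'.
Proof. by move=> sub; apply: le_output_prob => Xs; apply: hit_sub. Qed.

Lemma sparse_mean_union t (a : U -> R) :
  sparse_mean t (fun X => \sum_(v in X) a v) = (\sum_v a v) * 2 ^- t.
Proof.
rewrite /sparse_mean.
under eq_fun do rewrite big_mkcond /=.
rewrite mean_sum mulr_suml; apply: eq_bigr => v _.
rewrite -(sparse_mem t v) /sparse_mean -mean_scale.
congr (mean _); apply/funext => f; by case: ifP; rewrite ?mulr1 ?mulr0.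
Qed.

(** First-moment bound: however s is split, the scales sum to s, so a fixed tuple survives with
    probability 2^-s. *)
Lemma hit_prob_le k s E : hit_prob k s E <= (tuple_count k.+1 E)%:R * 2 ^- s.
Proof.
elim: k s E => [|k IH] s E.
  rewrite hit_prob0 tuple_countS natr_sum -sparse_mean_union.
  apply: ler_sparse_mean => X; rewrite -natr_sum ler_nat.
  have := tuple_count_link 0 X E; rewrite !tuple_count0 => h.
  exact: leq_trans h _.
rewrite hit_probS ler_pdivrMr ?ltr0n //.
rewrite mulr_natr -[in leRHS](card_ord s.+1) -sumr_const ler_sum // => t _.
have ts : (t <= s)%N by rewrite -ltnS.
rewrite -[in leRHS](subnK ts) exprD invfM mulrA mulrAC tuple_countS natr_sum.
rewrite mulrC -sparse_mean_union /sparse_mean -mean_scale.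
apply: ler_mean => f; rewrite mulrC; apply: le_trans (IH _ _) _.
rewrite ler_wpM2r ?invr_ge0 ?exprn_ge0 // -natr_sum ler_nat.
exact: tuple_count_link.
Qed.

Lemma layer_sum s (c : U -> nat) :
  (minn (2 ^ s) (\sum_v c v) <=
   \sum_(t < s.+1) #|[set v | (2 ^ (s - t) <= c v)%N]| * 2 ^ (s - t))%N.
Proof.
(* Indexing by the exponent s - t and summing over the vertices last reduces the claim to
   [dyadic_layers] at each vertex. *)
rewrite (reindex_inj rev_ord_inj) /=.
under [in leqRHS]eq_bigr => t _ do
  rewrite subSS subKn -1?ltnS // -sum1_card big_distrl /= big_mkcond /=.
rewrite exchange_big /=.
apply: (@leq_trans (\sum_v minn (2 ^ s) (c v))).
  elim/big_rec2: _ => [|v x y _]; first by rewrite minn0.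
  by move: (2 ^ s)%N => z; lia.
apply: leq_sum => v _; apply: (@leq_trans (minn (2 ^ s.+1).-1 (c v))).
  by have := expn_gt0 2 s; rewrite expnS; lia.
apply: leq_trans (dyadic_layers _ _) _; apply: leq_sum => b _.
by rewrite inE; case: (leqP (2 ^ b)%N (c v)).
Qed.

(** Each of the k + 1 sets costs a factor 1/2 from [sparse_hit], and each of the k draws of a scale
    a factor of at most s + 1. *)
Lemma hit_prob_ge k s E :
  2 ^- k.+1 * s.+1%:R ^- k * Num.min 1 ((tuple_count k.+1 E)%:R * 2 ^- s) <=
  hit_prob k s E.
Proof.
elim: k s E => [|k IH] s E.
  rewrite hit_prob0 expr0 invr1 mulr1 mulrC expr1.
  pose B := [set v | E [:: v]].
  have -> : tuple_count 1 E = #|B|.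
    rewrite tuple_countS -sum1_card [RHS]big_mkcond /=; apply: eq_bigr => v _.
    by rewrite tuple_count0 inE; case: (E _).
  apply: le_trans (sparse_hit _ _) _; apply: ler_sparse_mean => X.
  rewrite ler_nat; case: (boolP [disjoint _ & _]) => // /pred0Pn[v /=].
  rewrite inE => /andP[Ev vX]; rewrite lt0b; apply/existsP; exists v.
  by rewrite vX.
rewrite hit_probS ler_pdivlMr ?ltr0n //.
pose c v := tuple_count k.+1 (fun t => E (v :: t)).
pose B (t : nat) := [set v | (2 ^ (s - t) <= c v)%N].
set a := 2 ^- k.+1 * s.+1%:R ^- k : R.
have s0 : 0 < s.+1%:R :> R by [].
have a0 : 0 <= a by rewrite mulr_ge0 ?invr_ge0 ?exprn_ge0.
(* The layers [B t] together carry the whole truncated count, by [layer_sum] and subadditivity of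
   truncation at 1; the factor 1/2 is kept for meeting them. *)
apply: (@le_trans _ _ (a / 2 * \sum_(t < s.+1) Num.min 1 (#|B t|%:R * 2 ^- t))).
  have -> : 2 ^- k.+2 * s.+1%:R ^- k.+1 *
      Num.min 1 ((tuple_count k.+2 E)%:R * 2 ^- s) * s.+1%:R =
    a / 2 * Num.min 1 ((tuple_count k.+2 E)%:R * 2 ^- s).
    move: (Num.min _ _) => m; rewrite /a [2 ^+ k.+2]exprSr [s.+1%:R ^+ k.+1]exprSr.
    rewrite !invfM; move: (2 ^- k.+1 : R) (s.+1%:R : R) (lt0r_neq0 s0).
    by move=> x z z0; field; rewrite expf_neq0 z0.
  rewrite ler_wpM2l ?(divr_ge0 a0) //.
  apply: (le_trans _ (min_sum _)); last first.
    by move=> t; rewrite mulr_ge0 ?invr_ge0 ?exprn_ge0.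
  have p0 : 0 < 2 ^+ s :> R by rewrite exprn_gt0.
  have -> : \sum_(t < s.+1) #|B t|%:R * 2 ^- t =
    (\sum_(t < s.+1) #|B t| * 2 ^ (s - t))%:R * 2 ^- s :> R.
    rewrite natr_sum mulr_suml; apply: eq_bigr => t _.
    have ts : (t <= s)%N by rewrite -ltnS.
    have -> : 2 ^+ s = 2 ^+ (s - t) * 2 ^+ t :> R by rewrite -exprD subnK.
    rewrite natrM natrX invfM mulrA mulfK //.
    by rewrite expf_neq0 // pnatr_eq0.
  have := layer_sum s c; rewrite -/(tuple_count _ _) -tuple_countS.
  rewrite -(ler_nat R) natr_min natrX => h.
  have : Num.min (2 ^+ s) (tuple_count k.+2 E)%:R * 2 ^- s <=
    (\sum_(t < s.+1) #|B t| * 2 ^ (s - t))%:R * 2 ^- s :> R.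
    by rewrite ler_pM2r ?invr_gt0.
  rewrite minr_pMl ?invr_ge0 ?(ltW p0) // divff ?lt0r_neq0 // => h'.
  by rewrite le_min h' ge_min lexx.
rewrite mulr_sumr ler_sum // => t _.
have ts : (t <= s)%N by rewrite -ltnS.
rewrite -mulrA [2^-1 * _]mulrC.
apply: le_trans (ler_wpM2l a0 (sparse_hit t (B t))) _.
rewrite /sparse_mean -mean_scale; apply: ler_mean => f.
set X := [set _ | _]; case: (boolP [disjoint _ & _]) => [_|].
  by rewrite mulr0 output_prob_ge0.
move=> /pred0Pn[v /=]; rewrite inE => /andP[vB vX]; rewrite mulr1.
(* The link of [X] contains that of [v], which has at least 2^(s - t) tuples; hence the minimum in
   the induction hypothesis is 1. *)
apply: (@le_trans _ _ (hit_prob k (s - t) (fun u => E (v :: u)))); last first.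
  by apply: hit_prob_sub => u Eu; apply/existsP; exists v; rewrite vX.
apply: (le_trans _ (IH _ _)).
have -> : Num.min 1 ((c v)%:R * 2 ^- (s - t)) = 1 :> R.
  apply/min_idPl; rewrite ler_pdivlMr ?exprn_gt0 // mul1r -natrX ler_nat.
  exact: vB.
rewrite mulr1 ler_wpM2l ?invr_ge0 ?exprn_ge0 //.
rewrite lef_pV2 ?posrE ?exprn_gt0 //.
by rewrite lerXn2r ?nnegrE // ler_nat ltnS leq_subr.
Qed.

End SparseSets.

(** * A single trial *)

Section Trial.
Variables (R : realType) (U : finType) (k : nat).
Local Notation d := k.+1.

(** Sparse sets may overlap; restricting the i-th one to colour i makes them disjoint, as the oracle
    requires. *)
Definition color_classes (chi : {ffun U -> 'I_d}) (Xs : d.-tuple {set U}) :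
    {ffun 'I_d -> {set U}} :=
  [ffun i => [set v in tnth Xs i | chi v == i]].

Definition trial (s : nat) : cid_algorithm U d bool :=
  bind (uniform U d [ffun _ : U => ord0 : 'I_d]) (fun chi =>
    bind (sparse_sets U d k s) (fun Xs => ask (color_classes chi Xs))).

Lemma num_queries_trial (O : cid_query U d -> bool) s :
  (num_queries O (trial s) <= 1)%N.
Proof.
rewrite /trial -(add0n 1%N) -{1}(num_queries_uniform O [ffun _ : U => ord0 : 'I_d]).
apply: num_queries_bind => chi.
rewrite -(add0n 1%N) -{1}(num_queries_sparse_sets O k s).
by apply: num_queries_bind => Xs; apply: num_queries_ask.
Qed.

Variable H : hypergraph U.
Hypothesis uniH : uniform_hypergraph d H.

Lemma ask_prob (E : pred bool) (A : {ffun 'I_d -> {set U}}) :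
  (forall i j, i != j -> [disjoint A i & A j]) ->
  output_prob R (@cid_oracle U d H) E (ask A) = (E (colorful_count H A != 0%N))%:R.
Proof.
move=> disA; rewrite /ask; case: insubP => [q _ vq|] /=.
  by rewrite /cid_oracle vq.
rewrite negb_and => /orP[/forallPn[i]|/forallPn[i /forallPn[j]]]; last first.
  by rewrite negb_imply => /andP[/disA ->].
rewrite negbK => /eqP Ai0; congr (E _)%:R; apply/esym/negbTE; rewrite negbK.
rewrite /colorful_count cards_eq0; apply/eqP/setP => e; rewrite !inE.
by apply/negbTE/nandP; right; apply/forallPn; exists i; rewrite Ai0 finset.setI0 cards0.
Qed.

(** Position i must carry colour i. This fixes the length as d and leaves at most one rainbow tuple
    per hyperedge. *)
Definition rainbow (chi : {ffun U -> 'I_d}) (t : seq U) : bool :=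
  ([set v in t] \in H) && (map chi t == enum 'I_d).

Lemma rainbowP (chi : {ffun U -> 'I_d}) t :
  reflect (exists f : 'I_d -> U, [/\ t = map f (enum 'I_d),
     [set f i | i : 'I_d] \in H & forall i, chi (f i) = i]) (rainbow chi t).
Proof.
have im (f : 'I_d -> U) : [set v in map f (enum 'I_d)] = [set f i | i : 'I_d].
  apply/setP => v; rewrite inE; apply/mapP/imsetP => -[i _ ->]; exists i => //.
  by rewrite mem_enum.
apply: (iffP andP) => [[tH /eqP chit]|[f [-> fH chif]]].
  have st : size t == d by rewrite -(size_map chi) chit size_enum_ord.
  pose f := tnth (Tuple st).
  have tE : t = map f (enum 'I_d) by rewrite map_tnth_enum.
  exists f; split=> //; first by rewrite -im -tE.
  move=> i; move: chit; rewrite tE -map_comp -[RHS]map_id => /eq_in_map/(_ i) /=.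
  by apply; rewrite mem_enum.
rewrite im; split=> //; apply/eqP; rewrite -map_comp -[RHS]map_id.
by apply: eq_map => i /=.
Qed.

(** The vertices that a hyperedge has in the d classes are distinct, so by uniformity they exhaust
    it; listed by colour they form a rainbow tuple. *)
Lemma colorful_hit chi (Xs : d.-tuple {set U}) :
  (colorful_count H (color_classes chi Xs) != 0%N) = hit Xs (rainbow chi).
Proof.
have all2_enum (f : 'I_d -> U) :
    all2 (fun v (X : {set U}) => v \in X) (map f (enum 'I_d)) Xs =
    [forall i, f i \in tnth Xs i].
  rewrite -[in LHS](map_tnth_enum Xs).
  transitivity (all (fun i => f i \in tnth Xs i) (enum 'I_d)).
    by elim: (enum _) => //= i s ->.
  apply/allP/forallP => [h i|h i _]; last exact: h.
  by apply: h; rewrite mem_enum.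
apply/idP/hitP => [|[t /rainbowP[f [-> fH chif]]]].
  rewrite -lt0n => /card_gt0P[e]; rewrite inE => /andP[eH /forallP eA].
  have /fin_all_exists[f fP] : forall i, exists v,
      e :&: color_classes chi Xs i = [set v].
    by move=> i; apply/cards1P.
  have fe i : [/\ f i \in e, f i \in tnth Xs i & chi (f i) = i].
    have : f i \in [set f i] by rewrite inE.
    by rewrite -fP !inE ffunE !inE => /and3P[-> -> /eqP].
  exists (map f (enum 'I_d)); last first.
    by rewrite all2_enum; apply/forallP => i; case: (fe i).
  apply/rainbowP; exists f; split=> // [|i]; last by case: (fe i).
  suff -> : [set f i | i : 'I_d] = e by [].
  apply/eqP; rewrite eqEcard; apply/andP; split.
    by apply/fintype.subsetP => v /imsetP[i _ ->]; case: (fe i).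
  rewrite card_imset; last first.
    by move=> i j fij; case: (fe i) (fe j) => _ _ <- [_ _ <-]; rewrite fij.
  by move/forall_inP/(_ e eH)/eqP: uniH => ->; rewrite card_ord.
rewrite all2_enum => /forallP fX; rewrite -lt0n; apply/card_gt0P.
exists [set f i | i : 'I_d]; rewrite inE fH; apply/forallP => i.
apply/cards1P; exists (f i); apply/setP => v; rewrite !inE ffunE !inE.
apply/andP/eqP => [[/imsetP[j _ ->]] /andP[_ /eqP]|->].
  by rewrite chif => ->.
by split; rewrite ?imset_f ?fX ?chif /=.
Qed.

Lemma trial_prob s :
  output_prob R (@cid_oracle U d H) id (trial s) =
  mean (fun chi => hit_prob R (@cid_oracle U d H) k s (rainbow chi)).
Proof.
rewrite output_prob_bind_uniform; congr (mean _); apply/funext => chi.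
transitivity (output_prob R (@cid_oracle U d H) id
  (bind (sparse_sets U d k s) (fun Xs => Return U d (hit Xs (rainbow chi))))).
  apply: eq_output_prob_bind => Xs; rewrite ask_prob /= ?colorful_hit // => i j ij.
  apply/pred0P => v /=; rewrite !ffunE !inE.
  by apply/negbTE; apply: contra ij => /andP[/andP[_ /eqP <-] /andP[_ /eqP <-]].
by rewrite output_prob_map.
Qed.

(** A rainbow tuple is determined by its vertex set, since the colour of a vertex gives its
    position. *)
Lemma rainbow_count_le chi : (tuple_count d (rainbow chi) <= #|H|)%N.
Proof.
rewrite /tuple_count.
rewrite (eq_bigr (fun t : d.-tuple U => if rainbow chi t then 1%N else 0%N)).
  2: by move=> t _; case: ifP.
rewrite -big_mkcond /= sum1_card.
rewrite -(card_in_imset (f := fun t : d.-tuple U => [set v in t])); last first.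
  move=> t t' /rainbowP[f [tE _ chif]] /rainbowP[f' [tE' _ chif']] eqt.
  apply: val_inj; rewrite /= tE tE'; apply: eq_map => i.
  have : f i \in [set v in t'].
    by rewrite -eqt inE memtE tE map_f // mem_enum.
  rewrite inE memtE tE' => /mapP[j _ fij].
  by rewrite fij -{1}(chif' j) -fij chif.
apply/subset_leq_card/fintype.subsetP => e /imsetP[t + ->].
by case/andP.
Qed.

(** Linearity of expectation: a fixed enumeration of a hyperedge is coloured in order with
    probability d^-d. *)
Lemma rainbow_count_mean :
  #|H|%:R * d%:R ^- d <= mean (fun chi => (tuple_count d (rainbow chi))%:R : R).
Proof.
under eq_fun do rewrite /tuple_count natr_sum.
rewrite mean_sum.
have tup e : e \in H -> exists t : d.-tuple U, uniq t && ([set v in t] == e).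
  move=> eH; have st : size (enum e) == d.
    by rewrite -cardE; move/forall_inP/(_ e eH): uniH.
  exists (Tuple st); rewrite enum_uniq /=; apply/eqP/setP => v.
  by rewrite inE [LHS]mem_enum.
apply: (@le_trans _ _ (\sum_(e in H) \sum_(t : d.-tuple U | [set v in t] == e)
    mean (fun chi => (rainbow chi t)%:R))); last first.
  rewrite (exchange_big_dep predT) //= ler_sum // => t _.
  case: (boolP ([set v in t] \in H)) => tH.
    rewrite (big_pred1 [set v in t]) // => e /=.
    by apply/andP/eqP => [[_ /eqP]|->] //; rewrite eqxx.
  rewrite big_pred0 => [|e]; last first.
    by apply/negbTE/negP => /andP[eH /eqP te]; rewrite te eH in tH.
  by rewrite /mean divr_ge0 // sumr_ge0.
rewrite mulr_natl -sumr_const ler_sum // => e eH.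
(* One enumeration of [e] suffices; the others only add nonnegative terms. *)
have [t /andP[ut te]] := tup e eH; rewrite (bigD1 t) //=.
apply: (@le_trans _ _ (mean (fun chi : {ffun U -> 'I_d} => (rainbow chi t)%:R))); last first.
  by rewrite lerDl sumr_ge0 // => *; rewrite /mean divr_ge0 // sumr_ge0.
(* Each vertex of [t] must receive its position as colour; the product of these independent
   conditions implies that [t] is rainbow. *)
pose F (v : U) (c : 'I_d) : R := ((v \in t) ==> (nat_of_ord c == index v t))%:R.
apply: (@le_trans _ _ (mean (fun chi : {ffun U -> 'I_d} => \prod_v F v (chi v)))).
  rewrite mean_prod -[in leLHS](size_tuple t) -(card_uniqP ut) -exprVn.
  rewrite -prodr_const big_mkcond /= le_eqVlt; apply/orP; left; apply/eqP.
  apply: eq_bigr => v _; rewrite /F.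
  case: (boolP (v \in t)) => /= vt; last by rewrite mean_cst ?card_ord.
  have it : (index v t < d)%N by rewrite -[X in (_ < X)%N](size_tuple t) index_mem.
  rewrite /mean (bigD1 (Ordinal it)) //= eqxx big1 ?addr0 ?card_ord ?mul1r //.
    by rewrite (card_uniqP ut) size_tuple.
  by move=> c; rewrite -val_eqE /= => /negbTE ->.
apply: ler_mean => chi; case: (boolP (rainbow chi t)) => [_|].
  by apply: prodr_ile1 => v _; rewrite /F; case: (_ ==> _); rewrite ?lexx ler01.
rewrite /rainbow (eqP te) eH /= => /negP nc.
suff [v nv] : exists v, ~~ ((v \in t) ==> (nat_of_ord (chi v) == index v t)).
  by rewrite (bigD1 v) //= /F (negbTE nv) mul0r.
apply/existsP; rewrite -negb_forall; apply/negP => /forallP all_t; apply: nc.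
apply/eqP; apply: (inj_map val_inj); rewrite val_enum_ord -map_comp.
apply: (@eq_from_nth _ 0%N); first by rewrite size_map size_tuple size_iota.
move=> i; rewrite size_map size_tuple => id'.
have v0 : U by have := tnth t ord0.
rewrite nth_iota // (nth_map v0) ?size_tuple // add0n /=.
have := implyP (all_t (nth v0 t i)); rewrite mem_nth ?size_tuple // => /(_ isT)/eqP ->.
by rewrite index_uniq ?size_tuple.
Qed.

Lemma trial_prob_le s :
  output_prob R (@cid_oracle U d H) id (trial s) <= #|H|%:R * 2 ^- s.
Proof.
rewrite trial_prob -[leRHS](@mean_cst _ {ffun U -> 'I_d}); last first.
  by apply/card_gt0P; exists [ffun => ord0].
apply: ler_mean => chi; apply: le_trans (hit_prob_le _ _ _ _ _) _.
by rewrite ler_wpM2r ?invr_ge0 ?exprn_ge0 // ler_nat rainbow_count_le.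
Qed.

Lemma trial_prob_ge s : (2 ^ s <= #|H|)%N ->
  (2 * d)%:R ^- d * s.+1%:R ^- k <=
  output_prob R (@cid_oracle U d H) id (trial s).
Proof.
move=> sH; rewrite trial_prob.
set w : R := 2 ^- d * s.+1%:R ^- k.
have w0 : 0 <= w by rewrite mulr_ge0 ?invr_ge0 ?exprn_ge0.
have p0 : 0 < 2 ^+ s :> R by rewrite exprn_gt0.
have m2 : 2 ^+ s <= #|H|%:R :> R by rewrite -natrX ler_nat.
have m0 : 0 < #|H|%:R :> R by exact: lt_le_trans m2.
(* For a count x, min (1, x 2^-s) is at least x / #|H|, because x and 2^s are at most #|H|. This
   bound is linear in x, so it can be averaged over colourings. *)
apply: (@le_trans _ _ (mean (fun chi => w / #|H|%:R * (tuple_count d (rainbow chi))%:R))).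
  rewrite mean_scale.
  have -> : (2 * d)%:R ^- d / s.+1%:R ^+ k = w / #|H|%:R * (#|H|%:R * d%:R ^- d).
    rewrite mulrA mulfVK ?lt0r_neq0 // natrM exprMn invfM /w.
    by rewrite -!mulrA; congr (_ * _); rewrite mulrC.
  by rewrite ler_wpM2l ?rainbow_count_mean // divr_ge0.
apply: ler_mean => chi; apply: (le_trans _ (hit_prob_ge _ _ _ _ _)).
rewrite -/w -mulrA ler_wpM2l // le_min mulrC ler_pdivrMr // mul1r ler_nat.
rewrite rainbow_count_le /= ler_wpM2l // lef_pV2 ?posrE //.
Qed.

End Trial.

(** * Rough estimation *)

Lemma expRN1_le_half (R : realType) : expR (- 1) <= 2^-1 :> R.
Proof.
rewrite expRN lef_pV2 ?posrE ?expR_gt0 //.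
by apply: le_trans (expR_ge1Dx _); lra.
Qed.

Lemma expR_half_le2 (R : realType) : expR 2^-1 <= 2 :> R.
Proof.
rewrite -[2^-1]opprK expRN -[leRHS]invrK lef_pV2 ?posrE ?expR_gt0 ?invr_gt0 //.
by apply: le_trans (expR_ge1Dx _); lra.
Qed.

Section RoughEstimation.
Variables (R : realType) (U : finType) (k : nat).
Local Notation d := k.+1.

(** The bound [s] is exclusive and levels are tried downwards. Rejecting all of them gives 0, the
    exact answer when there is no hyperedge. *)
Fixpoint scan (N th s : nat) : cid_algorithm U d R :=
  if s is s'.+1 then
    bind (count_yes (trial U k s') N) (fun y =>
      if (th <= y)%N then Return U d (2 ^+ s') else scan N th s')
  else Return U d 0.

Lemma num_queries_scan (O : cid_query U d -> bool) N th s :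
  (num_queries O (scan N th s) <= s * N)%N.
Proof.
elim: s => //= s IH; rewrite mulSn.
apply: leq_trans (num_queries_bind (b := s * N) _ _) _.
  by move=> y; case: ifP.
by rewrite leq_add2r num_queries_count_yes // num_queries_trial.
Qed.

Variable H : hypergraph U.
Hypothesis uniH : uniform_hypergraph d H.
Local Notation O := (@cid_oracle U d H).

(** Each level errs with probability at most 2^-th. The largest level with 2^s <= m is correct and
    rarely rejected; a higher one is rarely accepted if it lies outside the window, and harmless
    otherwise. *)
Lemma scan_fail (K : R) (N th S s : nat) :
  2 <= K -> 6 * N%:R <= th%:R * K ->
  4 * th%:R * ((2 * d)%:R ^+ d * S%:R ^+ k) <= N%:R :> R ->
  (s <= S)%N -> (#|H| < 2 ^ s)%N ->
  output_prob R O (predC (estimates_within K #|H|)) (scan N th s)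
    <= s%:R * 2 ^- th.
Proof.
move=> K2 hK hN; elim: s => [|s IH] sS mS.
  rewrite /= mul0r /estimates_within.
  by move: mS; rewrite expn0 ltnS leqn0 => ->; rewrite eqxx.
have K0 : 0 < K by apply: lt_le_trans K2.
have e0 : 0 <= 2 ^- th :> R by rewrite invr_ge0 exprn_ge0.
have s0 : 0 < 2 ^+ s :> R by rewrite exprn_gt0.
have Q0 := output_prob_ge0 R O id (trial U k s).
set Q := output_prob R O id _ in Q0.
have [sm|ms] := leqP (2 ^ s) #|H|.
  (* Here m lies between 2^s and 2^(s+1), so K >= 2 absorbs the rounding. *)
  have good : estimates_within K #|H| (2 ^+ s).
    have m0 : (0 < #|H|)%N by apply: leq_trans sm; rewrite expn_gt0.
    rewrite /estimates_within.
    rewrite -[_ == _]negbK -lt0n m0 /=.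
    have m0' : 0 < #|H|%:R :> R by rewrite ltr0n.
    have a1 : 2 ^+ s <= #|H|%:R :> R by rewrite -natrX ler_nat.
    have a2 : #|H|%:R <= 2 * 2 ^+ s :> R by rewrite -exprS -natrX ler_nat ltnW.
    rewrite ler_pdivlMr // ler_pdivrMr // mulrC mul1r ler_pdivrMr //.
    by apply/andP; split; nra.
  apply: (@le_trans _ _ (2 ^- th)); last by rewrite ler_peMl // ler1n.
  (* Lower tail: the weight 2^(th - y) is at least 1 whenever the level is rejected. *)
  apply: le_trans (count_yes_moment (a := 2 ^+ th) (x := 2^-1) (b := 0) _ _ _ _ _) _.
  - by rewrite exprn_ge0.
  - by rewrite invr_ge0.
  - move=> y; case: (leqP th y) => /= y_th.
      by rewrite good addr0 mulr_ge0 ?exprn_ge0 ?invr_ge0.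
    apply: le_trans (output_prob_le1 _ _ _ _) _.
    rewrite addr0 exprVn ler_pdivlMr ?exprn_gt0 // mul1r.
    by rewrite ler_weXn2l ?ler1n // ltnW.
  rewrite addr0 -/Q.
  have NQ : 4 * th%:R <= N%:R * Q.
    have := trial_prob_ge R uniH sm; rewrite -/Q => Qge.
    have p1 : 0 < (2 * d)%:R ^+ d :> R by rewrite exprn_gt0 // ltr0n muln_gt0.
    have p2 : 0 < s.+1%:R ^+ k :> R by rewrite exprn_gt0.
    have p3 : s.+1%:R ^+ k <= S%:R ^+ k :> R by rewrite lerXn2r ?nnegrE // ler_nat.
    have : 1 <= (2 * d)%:R ^+ d * s.+1%:R ^+ k * Q.
      by rewrite mulrC -ler_pdivrMr ?mulr_gt0 // div1r invfM.
    move=> h1; apply: (@le_trans _ _ (4 * th%:R * ((2 * d)%:R ^+ d * s.+1%:R ^+ k * Q))).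
      by rewrite ler_peMr // mulr_ge0.
    rewrite mulrA ler_wpM2r //; apply: le_trans hN.
    by rewrite ler_wpM2l ?mulr_ge0 // ler_wpM2l // ltW.
  have -> : 2^-th = 2 ^+ th * 2 ^- (2 * th) :> R.
    by rewrite mulnC exprM invfM mulrA divff ?mul1r // expf_neq0 // pnatr_eq0.
  rewrite ler_wpM2l ?exprn_ge0 //.
  (* (1 - Q/2)^N <= exp (- N Q / 2) <= exp (- 2 th) <= 2^-(2 th). *)
  apply: (@le_trans _ _ (expR (- (Q / 2)) ^+ N)).
    rewrite lerXn2r ?nnegrE ?expR_ge0 //.
      by have := output_prob_le1 R O id (trial U k s); rewrite -/Q; lra.
    by apply: le_trans (expR_ge1Dx _); lra.
  rewrite -expRM_natl -exprVn.
  apply: (@le_trans _ _ (expR (- 1) ^+ (2 * th))).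
    by rewrite -expRM_natl ler_expR natrM; nra.
  by rewrite lerXn2r ?nnegrE ?expR_ge0 ?invr_ge0 // expRN1_le_half.
have {}IH := IH (ltnW sS) ms.
case good : (estimates_within K #|H| (2 ^+ s)).
  apply: (@le_trans _ _ (s%:R * 2 ^- th)); last by rewrite ler_wpM2r // ler_nat.
  (* With coefficient 0 only the constant term remains: acceptance is correct, and rejection leaves
     the error of the lower levels. *)
  rewrite -[leRHS]add0r -[X in X + _](mul0r ((1 + (1 - 1) * Q) ^+ N)).
  apply: count_yes_moment => // y; rewrite mul0r add0r.
  by case: ifP => //= _; rewrite good mulr_ge0.
rewrite -natr1 mulrDl mul1r addrC.
(* Upper tail: the weight 4^(y - th) covers a wrong acceptance, the constant term a rejection. *)
apply: le_trans (count_yes_moment (a := 4 ^- th) (x := 4) (b := s%:R * 2 ^- th) _ _ _ _ _) _.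
- by rewrite invr_ge0 exprn_ge0.
- by [].
- move=> y; case: (leqP th y) => /= y_th; last first.
    by rewrite -[leLHS]add0r lerD // mulr_ge0 ?invr_ge0 ?exprn_ge0.
  rewrite good /= -[leLHS]addr0 lerD ?mulr_ge0 //.
  by rewrite mulrC ler_pdivlMr ?exprn_gt0 // mul1r ler_weXn2l // ler1n.
rewrite -/Q lerD2r.
(* Since 2^s > m, the value 2^s can only be too large: K m < 2^s, hence K Q <= 1. If m = 0 then Q =
   0. *)
have NQ : 6 * (N%:R * Q) <= th%:R.
  have := trial_prob_le R uniH s; rewrite -/Q.
  move: good; rewrite /estimates_within; case: eqP => [->|/eqP m0].
    by rewrite mul0r => _ Qle; have -> : Q = 0; [apply/le_anti/andP|rewrite !mulr0].
  have m0' : 0 < #|H|%:R :> R by rewrite ltr0n lt0n.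
  have a1 : #|H|%:R <= 2 ^+ s :> R by rewrite -natrX ler_nat ltnW.
  move=> /negbT; rewrite negb_and -!ltNge => /orP[|].
    rewrite ltr_pdivrMr // mulrC div1r ltr_pdivlMr //; nra.
  rewrite ltr_pdivlMr // => KH; rewrite ler_pdivlMr // => Qle.
  have : K * Q <= 1 by nra.
  move=> KQ; have N0 : 0 <= N%:R :> R by [].
  have : 0 <= th%:R :> R by [].
  nra.
apply: (@le_trans _ _ (4 ^- th * 2 ^+ th)).
  rewrite ler_wpM2l ?invr_ge0 ?exprn_ge0 //.
  (* (1 + 3 Q)^N <= exp (3 N Q) <= exp (th / 2) <= 2^th. *)
  apply: (@le_trans _ _ (expR (3 * Q) ^+ N)).
    rewrite lerXn2r ?nnegrE ?expR_ge0 //; first by nra.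
    by apply: le_trans (expR_ge1Dx _); lra.
  rewrite -expRM_natl; apply: (@le_trans _ _ (expR 2^-1 ^+ th)).
    by rewrite -expRM_natl ler_expR; lra.
  by rewrite lerXn2r ?nnegrE ?expR_ge0 // expR_half_le2.
have -> : 4 = 2 * 2 :> R by rewrite -natrM.
by rewrite exprMn invfM -mulrA mulVf ?mulr1 // expf_neq0 // pnatr_eq0.
Qed.

End RoughEstimation.

(** * Number of hyperedges, integer logarithm and choice of parameters *)

Lemma leq_bin_expn n j : ('C(n, j) <= n ^ j)%N.
Proof.
apply: (@leq_trans (n ^_ j)); first by rewrite -bin_ffact leq_pmulr // fact_gt0.
elim: j => [|j IH]; first by rewrite ffactn0.
by rewrite ffactnSr expnSr leq_mul // leq_subr.
Qed.

Lemma card_uniform_hypergraph (U : finType) (d : nat) (H : hypergraph U) :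
  uniform_hypergraph d H -> (#|H| <= #|U| ^ d)%N.
Proof.
move=> uniH; apply: leq_trans (leq_bin_expn _ _).
rewrite -card_draws; apply/subset_leq_card/fintype.subsetP => e eH.
by rewrite inE; move/forall_inP/(_ e eH): uniH.
Qed.

Lemma trunc_log_le_log2 (R : realType) (n : nat) :
  (0 < n)%N -> (trunc_log 2 n)%:R <= log2 (n%:R : R).
Proof.
move=> n0; have l2 : 0 < ln 2 :> R by rewrite ln_gt0 // ltr1n.
rewrite /log2 ler_pdivlMr // mulr_natl -lnXn // ler_ln ?posrE ?exprn_gt0 ?ltr0n //.
by rewrite -natrX ler_nat trunc_logP.
Qed.

Theorem theorem1 (R : realType) :
  exists2 c : R, 0 < c &
  forall d : nat, (2 <= d)%N ->
  exists2 C : R, 0 < C &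
  exists rough_estimation : forall U : finType, cid_algorithm U d R,
  forall (U : finType) (H : hypergraph U), uniform_hypergraph d H ->
  let n : R := #|U|%:R in
  let oracle := @cid_oracle U d H in
  1 - 1 / n `^ (c * d%:R) <=
    output_prob R oracle
      (estimates_within (C * log2 n ^+ d.-1) #|H|) (rough_estimation U) /\
  (num_queries oracle (rough_estimation U))%:R <= C * log2 n ^+ d.+2.
Proof.
exists 1 => // -[//|k] k1.
pose d := k.+1; rewrite -/d.
pose D : R := (2 * d)%:R.
have D1 : 1 <= D by rewrite ler1n muln_gt0.
have D0 : 0 < D by apply: lt_le_trans D1.
(* The window needs 24 D^d S^(d-1) <= K and the query count is 8 D^d S^(d+1); as S <= D log n, this
   constant serves both. *)
exists (24 * D ^+ d * D ^+ d.+1).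
  by apply: mulr_gt0; [apply: mulr_gt0|]; rewrite ?exprn_gt0 ?ltr0n.
(* m <= n ^ d < 2 ^ S, so the levels below S suffice; with threshold 2 S each
   of them errs with probability at most 2 ^ - (2 S). *)
pose S (n : nat) := (d * (trunc_log 2 n).+1)%N.
(* With threshold th = 2 S, the factor 8 makes N equal to 4 th (2d)^d S^(d-1), as the lower tail
   requires. *)
pose N n := (8 * (2 * d) ^ d * S n ^ d)%N.
exists (fun U : finType => if (#|U| <= 1)%N then Return U d 0
  else @scan R U k (N #|U|) (2 * S #|U|) (S #|U|)).
move=> U H uniH n oracle.
have cardH := card_uniform_hypergraph uniH.
case: leqP => [U1|U1].
  have H0 : #|H| = 0%N.
    apply/eqP; rewrite cards_eq0; apply/eqP/setP => e; rewrite inE.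
    apply/negP => eH; move/forall_inP/(_ e eH)/eqP: uniH => ed.
    by have := leq_trans (max_card (mem e)) U1; rewrite ed leqNgt k1.
  rewrite /= /estimates_within H0 !eqxx; split.
    by rewrite gerBl divr_ge0 // powR_ge0.
  (* For n = 0 this is the convention ln 0 = 0; the query bound is then 0, and no query is made. *)
  have -> : log2 n = 0.
    rewrite /log2 /n; move: U1; case: #|U| => [|[|//]] _.
      by rewrite ln0 ?mul0r.
    by rewrite ln1 mul0r.
  by rewrite expr0n /= mulr0.
set t := trunc_log 2 #|U|; set lg := log2 n.
have t1 : (1 <= t)%N by rewrite trunc_log_gt0.
have tlg : t%:R <= lg by apply: trunc_log_le_log2; apply: ltn_trans U1.
have lg1 : 1 <= lg by apply: le_trans tlg; rewrite ler1n.
have lg0 : 0 <= lg by apply: le_trans lg1.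
have SD : (S #|U|)%:R <= D * lg.
  apply: (@le_trans _ _ (D * t%:R)); last by rewrite ler_wpM2l // ltW.
  (* As t >= 1, d (t + 1) <= 2 d t; hence D = 2 d. *)
  rewrite /D -natrM ler_nat /S -/t; nia.
have SDX j : (S #|U|)%:R ^+ j <= D ^+ j * lg ^+ j.
  by rewrite -exprMn lerXn2r ?nnegrE // mulr_ge0 // ltW.
have NE : (N #|U|)%:R = 8 * D ^+ d * (S #|U|)%:R ^+ d :> R.
  by rewrite /N /D 2!natrM !natrX.
have X0 j : 0 <= D ^+ j by rewrite exprn_ge0 // ltW.
have L0 j : 0 <= lg ^+ j by rewrite exprn_ge0.
split; last first.
  apply: (@le_trans _ _ (S #|U| * N #|U|)%:R).
    by rewrite ler_nat num_queries_scan.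
  rewrite natrM NE mulrCA -exprS.
  apply: (@le_trans _ _ (8 * D ^+ d * (D ^+ d.+1 * lg ^+ d.+1))).
    by rewrite ler_wpM2l // mulr_ge0.
  rewrite mulrA; apply: (@le_trans _ _ (24 * D ^+ d * D ^+ d.+1 * lg ^+ d.+1)).
    by rewrite ler_wpM2r // ler_wpM2r // ler_wpM2r // ler_nat.
  by rewrite ler_wpM2l ?ler_weXn2l // mulr_ge0 // mulr_ge0.
rewrite output_probC lerD2l lerN2.
have nS : (#|U| ^ d < 2 ^ S #|U|)%N.
  by rewrite /S mulnC expnM ltn_exp2r // trunc_log_ltn.
apply: le_trans (scan_fail (S := S #|U|) uniH _ _ _ _ _) _ => //.
- have := mulr_ege1 (mulr_ege1 (exprn_ege1 d D1) (exprn_ege1 d.+1 D1))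
    (exprn_ege1 k lg1).
  by rewrite /=; lra.
- rewrite NE natrM -/d.
  apply: (@le_trans _ _ (48 * D ^+ d * (S #|U|)%:R * (D ^+ k * lg ^+ k))).
    rewrite [(S #|U|)%:R ^+ d]exprS; have := SDX k; have := X0 d.
    have := @ler0n R (S #|U|) => h1 h2 h3.
    have := ler_wpM2l (mulr_ge0 h2 h1) h3; lra.
  have h : D ^+ k <= D ^+ d.+1 by rewrite ler_weXn2l // leqW.
  have := ler_wpM2r (L0 k) h.
  move=> /(ler_wpM2l (mulr_ge0 (X0 d) (ler0n R (S #|U|)))); rewrite /=; lra.
- by rewrite NE natrM -/D [(S #|U|)%:R ^+ d]exprS; lra.
- exact: leq_ltn_trans cardH nS.
rewrite div1r mul1r powR_mulrn //.
(* One factor 2^-S pays for the union bound over S levels; the other is at most n^-d, so the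
   exponent constant is 1. *)
apply: (@le_trans _ _ (2 ^- S #|U|)).
  rewrite mul2n -addnn exprD invfM mulrA ler_piMl ?invr_ge0 ?exprn_ge0 //.
  by rewrite ler_pdivrMr ?exprn_gt0 // mul1r -natrX ler_nat ltnW // ltn_expl.
rewrite lef_pV2 ?posrE ?exprn_gt0 // /n ?ltr0n ?(ltn_trans _ U1) //.
by rewrite -!natrX ler_nat ltnW.
Qed.
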